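(* Let $G$ be a finite group of order $v$, let $k,\lambda,n,\mu,\nu$ be integers and let $\ell\ge 2$. Then a $(v,k,\lambda,n;\ell+1)$-linking system of difference sets in $G$ with respect to $\mu,\nu$ is equivalent to a reduced $(v,k,\lambda,n;\ell)$-linking system of difference sets in $G$ with respect to $\mu,\nu$, in the following sense: (a) if $\{D_{i,j} : 0\le i,j\le \ell,\ i\ne j\}$ is a $(v,k,\lambda,n;\ell+1)$-linking system of difference sets in $G$ with respect to $\mu,\nu$, then $\{D_{1,0},D_{2,0},\dots,D_{\ell,0}\}$ is a reduced $(v,k,\lambda,n;\ell)$-linking system of difference sets in $G$ with respect to $\mu,\nu$; (b) conversely, if $\{D_1,\dots,D_\ell\}$ is a reduced $(v,k,\lambda,n;\ell)$-linking system of difference sets in $G$ with respect to $\mu,\nu$, then there is a $(v,k,\lambda,n;\ell+1)$-linking system of difference sets $\{D_{i,j} : 0\le i,j\le \ell,\ i\ne j\}$ in $G$ with respect to $\mu,\nu$ such that $D_{i,0}=D_i$ for $1\le i\le \ell$.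
   Context: Groups are written multiplicatively and are not assumed abelian. For a group $G$ of order $v$, a subset $D\subseteq G$ with $k$ elements is a $(v,k,\lambda,n)$-difference set in $G$ if the multiset $\{d_1d_2^{-1} : d_1,d_2\in D,\ d_1\neq d_2\}$ contains every non-identity element of $G$ exactly $\lambda$ times, where $n:=k-\lambda$. A subset $S$ of $G$ is identified with the element $\sum_{s\in S}s$ of the group ring $\mathbb{Z}[G]$, and $S^{(-1)}:=\sum_{s\in S}s^{-1}$. Linking system: for $\ell\ge 2$, a collection (indexed family) $\{D_{i,j} : 0\le i,j\le\ell,\ i\ne j\}$ of $(v,k,\lambda,n)$-difference sets in $G$ is a $(v,k,\lambda,n;\ell+1)$-linking system of difference sets in $G$ with respect to the integers $\mu,\nu$ if, in $\mathbb{Z}[G]$, $D_{h,i}D_{i,j}=(\mu-\nu)D_{h,j}+\nu G$ for all distinct $i,j,h$, and $D_{i,j}=D_{j,i}^{(-1)}$ for all distinct $i,j$. Reduced linking system: for $\ell\ge 2$, a collection (indexed family) $\{D_1,\dots,D_\ell\}$ of $(v,k,\lambda,n)$-difference sets in $G$ is a reduced $(v,k,\lambda,n;\ell)$-linking system of difference sets in $G$ (of size $\ell$) with respect to the integers $\mu,\nu$ if for all distinct $i,j$ there is some $(v,k,\lambda,n)$-difference set $D(i,j)$ in $G$ (not necessarily one of the $D_r$) with $D_iD_j^{(-1)}=(\mu-\nu)D(i,j)+\nu G$ in $\mathbb{Z}[G]$. *)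

(* Defs.v *)
From HB Require Import structures.
From mathcomp Require Import all_boot all_order all_algebra all_fingroup.

Set Implicit Arguments.
Unset Strict Implicit.
Unset Printing Implicit Defensive.

Import GRing.Theory.
Local Open Scope ring_scope.

(* The integral group ring Z[gT]: functions gT -> Z under convolution.  A type
   alias is needed because {ffun gT -> int} already has a pointwise product. *)
Definition zgroup_ring (gT : finGroupType) := {ffun gT -> int}.

HB.instance Definition _ (gT : finGroupType) :=
  GRing.Zmodule.on (zgroup_ring gT).

Section GroupRing.
Variable gT : finGroupType.
Implicit Types a b c : zgroup_ring gT.

Definition zgr_elt (s : gT) : zgroup_ring gT := [ffun x => (x == s)%:R].

Definition zgr_mul a b : zgroup_ring gT :=
  [ffun x => \sum_(y : gT) a y * b (y^-1 * x)%g].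

Fact zgr_mulA : associative zgr_mul.
Proof.
move=> a b c; apply/ffunP=> x; rewrite !ffunE.
under eq_bigr => y _ do rewrite ffunE mulr_sumr.
under [RHS]eq_bigr => z _ do rewrite ffunE mulr_suml.
rewrite [RHS]exchange_big /=; apply: eq_bigr => y _.
rewrite [RHS](reindex_inj (mulgI y)) /=; apply: eq_bigr => z _.
by rewrite mulKg invMg -mulgA mulrA.
Qed.

Fact zgr_mul1g : left_id (zgr_elt 1) zgr_mul.
Proof.
move=> a; apply/ffunP=> x; rewrite !ffunE (bigD1 1%g) //= big1 => [|y].
  by rewrite ffunE eqxx mul1r invg1 mul1g addr0.
by rewrite ffunE => /negPf->; rewrite mul0r.
Qed.

Fact zgr_mulg1 : right_id (zgr_elt 1) zgr_mul.
Proof.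
move=> a; apply/ffunP=> x; rewrite !ffunE (bigD1 x) //= big1 => [|y neq_yx].
  by rewrite ffunE mulVg eqxx mulr1 addr0.
by rewrite ffunE -eq_invg_mul invgK (negPf neq_yx) mulr0.
Qed.

Fact zgr_mulDl : left_distributive zgr_mul +%R.
Proof.
move=> a b c; apply/ffunP=> x; rewrite !ffunE -big_split /=.
by apply: eq_bigr => y _; rewrite ffunE mulrDl.
Qed.

Fact zgr_mulDr : right_distributive zgr_mul +%R.
Proof.
move=> a b c; apply/ffunP=> x; rewrite !ffunE -big_split /=.
by apply: eq_bigr => y _; rewrite ffunE mulrDr.
Qed.

Fact zgr_oner_neq0 : zgr_elt 1 != 0.
Proof. by apply/eqP=> /ffunP/(_ 1%g); rewrite !ffunE eqxx. Qed.

HB.instance Definition _ := GRing.Zmodule_isNzRing.Build (zgroup_ring gT)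
  zgr_mulA zgr_mul1g zgr_mulg1 zgr_mulDl zgr_mulDr zgr_oner_neq0.

Lemma zgr_eltM (x y : gT) : zgr_elt (x * y)%g = zgr_elt x * zgr_elt y.
Proof.
apply/ffunP=> z; rewrite !ffunE (bigD1 x) //= big1 => [|t neq_tx].
  by rewrite !ffunE eqxx mul1r addr0 -(inj_eq (mulgI x) (x^-1 * z)%g) mulKVg.
by rewrite ffunE (negPf neq_tx) mul0r.
Qed.

Definition zgr_set (S : {set gT}) : zgroup_ring gT := \sum_(s in S) zgr_elt s.

(* S^(-1), the sum of the inverses of the elements of S *)
Definition zgr_setV (S : {set gT}) : zgroup_ring gT :=
  \sum_(s in S) zgr_elt (s^-1)%g.

End GroupRing.

Definition difference_set (gT : finGroupType) (v : nat) (k lambda n : int)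
    (D : {set gT}) : Prop :=
  [/\ #|gT| = v, #|D|%:Z = k, n = k - lambda &
      forall g : gT, g != 1%g ->
        #|[set d in setX D D | (d.1 != d.2) && (d.1 * d.2^-1 == g)%g]|%:Z
          = lambda].

(* A (v, k, lambda, n; l + 1)-linking system; the diagonal values D i i of the
   family are junk and unconstrained. *)
Definition linking_system (gT : finGroupType) (v : nat) (k lambda n : int)
    (l : nat) (mu nu : int) (D : 'I_l.+1 -> 'I_l.+1 -> {set gT}) : Prop :=
  [/\ (2 <= l)%N,
      forall i j, i != j -> difference_set v k lambda n (D i j),
      forall h i j, h != i -> i != j -> h != j ->
        zgr_set (D h i) * zgr_set (D i j)
          = zgr_set (D h j) *~ (mu - nu) + zgr_set [set: gT] *~ nu &
      forall i j, i != j -> zgr_set (D i j) = zgr_setV (D j i)].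

(* A reduced (v, k, lambda, n; l)-linking system D_1, ..., D_l, with D_(i + 1)
   at index i : 'I_l. *)
Definition reduced_linking_system (gT : finGroupType) (v : nat)
    (k lambda n : int) (l : nat) (mu nu : int) (D : 'I_l -> {set gT}) : Prop :=
  [/\ (2 <= l)%N,
      forall i, difference_set v k lambda n (D i) &
      forall i j, i != j ->
        exists2 Dij : {set gT}, difference_set v k lambda n Dij &
          zgr_set (D i) * zgr_setV (D j)
            = zgr_set Dij *~ (mu - nu) + zgr_set [set: gT] *~ nu].

(* Main.v *)
Require Import Defs.
From HB Require Import structures.
From mathcomp Require Import all_boot all_order all_algebra all_fingroup.
From mathcomp Require Import ring lra zify.

Set Implicit Arguments.
Unset Strict Implicit.
Unset Printing Implicit Defensive.

Local Open Scope ring_scope.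

Import Order.TTheory GRing.Theory Num.Theory.

(** Write M = mu - nu, J for the sum of all elements of the group G, and a* for
    the image of a under the involution x |-> x^-1 of Z[G].

    From a linking system, a reduced one is obtained because
    D_(i,0) D_(j,0)* = D_(i,0) D_(0,j) is the linking relation for the triple
    i, 0, j.

    For the converse put D_(i,0) = D_i, D_(0,i) = D_i* and D_(i,j) = D(i,j).
    A (v, k, lambda, n)-difference set is a 0-1 element a of augmentation k with
    a a* = n + lambda J ([difference_setE]). As n + lambda J is central, also
    a* a = n + lambda J: the element a* a - n - lambda J is self-adjoint and its
    square has coefficient 0 at the identity, but that coefficient is a sum of
    squares ([zgr_normal]). So inverting a difference set gives one with the
    same parameters.

    If k = 0 or k = v, all the sets of size k coincide and the constant family
    works ([constant_linking_system]). Otherwise n <> 0, and computing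
    (a b* )(a b* )* in two ways, where a b* = M e + nu J, gives
    n = M^2 and lambda k = M nu + nu k ([linking_param]). In particular M <> 0,
    so Z[G] being torsion free, e is determined by a and b; this yields
    D(i,j)* = D(j,i). The linking relations follow by cancelling M
    ([linking_starl], [linking_starr], [linking_mul]). *)

(** * Coefficients, trace and involution of the integral group ring *)

Section GroupRingTheory.
Variable gT : finGroupType.
Implicit Types (a b c : zgroup_ring gT) (S D : {set gT}) (x y : gT) (m : int).

(** Evaluation at x, named so that it can carry the structure of an additive
    morphism Z[G] -> Z. *)
Definition zgr_coef x a : int := a x.

Fact zgr_coef_is_additive x : zmod_morphism (zgr_coef x).
Proof. by move=> a b; rewrite /zgr_coef !ffunE. Qed.

HB.instance Definition _ x :=
  GRing.isZmodMorphism.Build (zgroup_ring gT) int (zgr_coef x)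
    (zgr_coef_is_additive x).

Lemma zgr_coefP a b : (forall x, zgr_coef x a = zgr_coef x b) -> a = b.
Proof. by move=> eq_ab; apply/ffunP=> x; apply: eq_ab. Qed.

Lemma zgr_coefMz x a m : zgr_coef x (a *~ m) = zgr_coef x a * m.
Proof. by rewrite raddfMz mulrzz. Qed.

Lemma zgr_coefM x a b :
  zgr_coef x (a * b) = \sum_y zgr_coef y a * zgr_coef (y^-1 * x)%g b.
Proof. by rewrite /zgr_coef ffunE. Qed.

Lemma zgr_coef_elt x y : zgr_coef x (zgr_elt y) = (x == y)%:R.
Proof. by rewrite /zgr_coef ffunE. Qed.

Lemma zgr_coef1 x : zgr_coef x 1 = (x == 1%g)%:R.
Proof. exact: zgr_coef_elt. Qed.

Lemma zgr_coef_set x S : zgr_coef x (zgr_set S) = (x \in S)%:R.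
Proof.
rewrite /zgr_set raddf_sum /=; under eq_bigr => s _ do rewrite zgr_coef_elt.
have [xS | xNS] := boolP (x \in S).
  rewrite (bigD1 x) //= eqxx big1 ?addr0 // => y /andP[_ /negPf].
  by rewrite eq_sym => ->.
by rewrite big1 // => y yS; case: eqP => // eq_xy; rewrite eq_xy yS in xNS.
Qed.

Lemma zgr_setV_inv S : zgr_setV S = zgr_set (S^-1)%g.
Proof.
rewrite /zgr_setV /zgr_set [RHS](reindex_inj invg_inj) /=.
by apply: eq_bigl => x; rewrite memV_invg.
Qed.

Lemma zgr_mulIz m : m != 0 -> injective (fun a => a *~ m).
Proof.
move=> m_neq0 a b eq_abm; apply: zgr_coefP => x; apply: (mulIf m_neq0).
by rewrite -!zgr_coefMz eq_abm.
Qed.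

(** The coefficient at the identity is a trace, although Z[G] need not be
    commutative. *)
Lemma zgr_trC a b : zgr_coef 1 (a * b) = zgr_coef 1 (b * a).
Proof.
rewrite !zgr_coefM [RHS](reindex_inj invg_inj) /=.
by apply: eq_bigr => y _; rewrite !mulg1 invgK mulrC.
Qed.

Definition zgr_star a : zgroup_ring gT := [ffun x => a (x^-1)%g].

Lemma zgr_coef_star x a : zgr_coef x (zgr_star a) = zgr_coef x^-1%g a.
Proof. by rewrite /zgr_coef ffunE. Qed.

Fact zgr_star_is_additive : zmod_morphism zgr_star.
Proof. by move=> a b; apply/ffunP=> x; rewrite !ffunE. Qed.

HB.instance Definition _ :=
  GRing.isZmodMorphism.Build (zgroup_ring gT) (zgroup_ring gT) zgr_star
    zgr_star_is_additive.

Lemma zgr_starK : involutive zgr_star.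
Proof. by move=> a; apply: zgr_coefP => x; rewrite !zgr_coef_star invgK. Qed.

Lemma zgr_starM a b : zgr_star (a * b) = zgr_star b * zgr_star a.
Proof.
apply: zgr_coefP => x; rewrite zgr_coef_star !zgr_coefM.
rewrite [RHS](reindex_inj (mulgI x)) /=; apply: eq_bigr => y _.
by rewrite !zgr_coef_star !invMg !invgK mulKg mulrC.
Qed.

Lemma zgr_star_set S : zgr_star (zgr_set S) = zgr_setV S.
Proof.
apply: zgr_coefP => x.
by rewrite zgr_setV_inv zgr_coef_star !zgr_coef_set mem_invg.
Qed.

(** The coefficient of a a* at the identity is the sum of the squares of the
    coefficients of a. *)
Lemma zgr_tr_star_eq0 a : zgr_coef 1 (a * zgr_star a) = 0 -> a = 0.
Proof.
rewrite zgr_coefM => /eqP; rewrite psumr_eq0 => [/allP tr0 | y _]; last first.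
  by rewrite zgr_coef_star mulg1 invgK -expr2 sqr_ge0.
apply: zgr_coefP => x; rewrite raddf0; apply/eqP.
have /= := tr0 x (mem_index_enum x).
by rewrite zgr_coef_star mulg1 invgK mulf_eq0 orbb.
Qed.

(** With x = a* a, centrality of c gives x^2 = a* (a a* ) a = c x, so
    (x - c) (x - c)* = (x - c)^2 = c (c - x); the trace of c x is that of
    a c a* = c^2, hence x - c vanishes by positivity. This replaces the usual
    argument that a one-sided inverse in a finite-dimensional algebra is
    two-sided, and avoids inverting n over the rationals. *)
Lemma zgr_normal a c :
  (forall b, c * b = b * c) -> a * zgr_star a = c -> zgr_star a * a = c.
Proof.
move=> cC aaE; have star_c : zgr_star c = c.
  by rewrite -aaE zgr_starM zgr_starK.
set x := zgr_star a * a.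
have star_x : zgr_star x = x by rewrite zgr_starM zgr_starK.
have xx : x * x = c * x by rewrite /x mulrA -(mulrA _ a) aaE -cC -mulrA.
apply/eqP; rewrite -subr_eq0; apply/eqP; apply: zgr_tr_star_eq0.
rewrite raddfB /= star_x star_c.
rewrite mulrBr !mulrBl xx -[x * c]cC subrr sub0r opprB.
rewrite raddfB /= [c * x]mulrA [X in _ - X]zgr_trC mulrA -cC -mulrA aaE.
exact: subrr.
Qed.

(** * Augmentation, and multiples of the sum of the group *)

Definition zgr_aug a : int := \sum_x zgr_coef x a.

Let J : zgroup_ring gT := zgr_set [set: gT].

Lemma zgr_coef_setT x : zgr_coef x J = 1.
Proof. by rewrite zgr_coef_set inE. Qed.

Lemma zgr_mulT a : a * J = J *~ zgr_aug a.
Proof.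
apply: zgr_coefP => x; rewrite zgr_coefMz zgr_coef_setT mul1r zgr_coefM.
by apply: eq_bigr => y _; rewrite zgr_coef_setT mulr1.
Qed.

Lemma zgr_star_setT : zgr_star J = J.
Proof. by apply: zgr_coefP => x; rewrite zgr_coef_star !zgr_coef_setT. Qed.

Lemma zgr_star_comb a m1 m2 :
  zgr_star (a *~ m1 + J *~ m2) = zgr_star a *~ m1 + J *~ m2.
Proof. by rewrite raddfD /= !raddfMz /= zgr_star_setT. Qed.

Lemma zgr_aug_star a : zgr_aug (zgr_star a) = zgr_aug a.
Proof.
rewrite /zgr_aug [RHS](reindex_inj invg_inj) /=.
by apply: eq_bigr => x _; rewrite zgr_coef_star.
Qed.

Lemma zgr_Tmul a : J * a = J *~ zgr_aug a.
Proof.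
apply: (can_inj zgr_starK).
by rewrite zgr_starM zgr_star_setT zgr_mulT raddfMz /= zgr_star_setT zgr_aug_star.
Qed.

Lemma zgr_aug_set S : zgr_aug (zgr_set S) = #|S|%:Z.
Proof.
rewrite /zgr_aug; under eq_bigr => x _ do rewrite zgr_coef_set.
by rewrite -sum1_card -natz natr_sum [RHS]big_mkcond; apply: eq_bigr => x _; case: ifP.
Qed.

Lemma zgr_augM a b : zgr_aug (a * b) = zgr_aug a * zgr_aug b.
Proof.
have: zgr_coef 1 (a * b * J) = zgr_coef 1 (a * (b * J)) by rewrite mulrA.
by rewrite !zgr_mulT mulrzAr zgr_mulT !zgr_coefMz zgr_coef_setT !mul1r.
Qed.

Lemma zgr_augDMz a b m1 m2 :
  zgr_aug (a *~ m1 + b *~ m2) = zgr_aug a * m1 + zgr_aug b * m2.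
Proof.
rewrite /zgr_aug !mulr_suml -big_split /=; apply: eq_bigr => x _.
by rewrite raddfD /= !zgr_coefMz.
Qed.

Lemma zgr_aug1 : zgr_aug 1 = 1.
Proof.
rewrite /zgr_aug (bigD1 1%g) //= zgr_coef1 eqxx big1 ?addr0 // => x.
by rewrite zgr_coef1 => /negPf->.
Qed.

Lemma zgr_augT : zgr_aug J = #|gT|%:Z.
Proof. by rewrite zgr_aug_set cardsT. Qed.

(** * Difference sets as elements of the group ring *)

(** The group ring equation of a difference set, for an arbitrary element: this
    form is stable under the involution and does not mention the set. *)
Definition diffset_elt (k lambda n : int) a :=
  zgr_aug a = k /\ a * zgr_star a = 1 *~ n + J *~ lambda.

Lemma zgr_central n lambda b :
  (1 *~ n + J *~ lambda) * b = b * (1 *~ n + J *~ lambda).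
Proof.
by rewrite mulrDl mulrDr !mulrzAl !mulrzAr mul1r mulr1 zgr_mulT zgr_Tmul.
Qed.

Lemma zgr_coef_diff x D :
  zgr_coef x (zgr_set D * zgr_star (zgr_set D))
    = #|[set d in setX D D | (d.1 * d.2^-1 == x)%g]|%:Z.
Proof.
rewrite zgr_star_set /zgr_set mulr_suml raddf_sum /=.
under eq_bigr => d1 _.
  rewrite mulr_sumr raddf_sum /=.
  under eq_bigr => d2 _ do rewrite -zgr_eltM zgr_coef_elt.
  over.
rewrite pair_big /= -sum1_card -natz natr_sum.
rewrite big_mkcond [RHS]big_mkcond; apply: eq_bigr => -[d1 d2] _.
by rewrite !inE /= eq_sym; case: (_ && _) => //=; case: ifP.
Qed.

(** For x <> 1, the coefficient of D D* at x counts the quotients equal to x,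
    and at 1 it is #|D|; the latter agrees with n + lambda because
    n = k - lambda, including when the group is trivial. *)
Lemma difference_setE v k lambda n D :
  difference_set v k lambda n D <->
  [/\ #|gT| = v, n = k - lambda & diffset_elt k lambda n (zgr_set D)].
Proof.
rewrite /diffset_elt zgr_aug_set.
have coefE x : x != 1%g -> zgr_coef x (zgr_set D * zgr_star (zgr_set D))
    = #|[set d in setX D D | (d.1 != d.2) && (d.1 * d.2^-1 == x)%g]|%:Z.
  move=> x_neq1; rewrite zgr_coef_diff; congr (Posz #|pred_of_set _|).
  apply/setP=> -[d1 d2]; rewrite !inE /=; congr (_ && _).
  by case: (eqVneq d1 d2) => //= ->; rewrite mulgV eq_sym (negPf x_neq1).
have coef1E : zgr_coef 1 (zgr_set D * zgr_star (zgr_set D)) = #|D|%:Z.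
  rewrite zgr_coefM -zgr_aug_set; apply: eq_bigr => y _.
  by rewrite zgr_coef_star mulg1 invgK zgr_coef_set; case: (y \in D).
have rhsE x : zgr_coef x (1 *~ n + J *~ lambda) = (x == 1%g)%:R * n + lambda.
  by rewrite raddfD /= !zgr_coefMz zgr_coef1 zgr_coef_setT mul1r.
split=> [[vE kE nE countE] | [vE nE [kE DDE]]]; split=> //.
- split=> //; apply: zgr_coefP => x; rewrite rhsE.
  have [-> | x_neq1] := eqVneq x 1%g; first by rewrite coef1E kE nE mul1r subrK.
  by rewrite coefE // countE // mul0r add0r.
- by move=> x x_neq1; rewrite -coefE // DDE rhsE (negPf x_neq1) mul0r add0r.
Qed.

Lemma diffset_elt_star k lambda n a :
  diffset_elt k lambda n a -> diffset_elt k lambda n (zgr_star a).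
Proof.
case=> kE aaE; split; first by rewrite zgr_aug_star.
rewrite zgr_starK; apply: zgr_normal aaE; exact: zgr_central.
Qed.

Lemma difference_setV v k lambda n D :
  difference_set v k lambda n D -> difference_set v k lambda n (D^-1)%g.
Proof.
move=> /difference_setE[vE nE D_ds]; apply/difference_setE; split=> //.
by rewrite -zgr_setV_inv -zgr_star_set; apply: diffset_elt_star.
Qed.

Lemma diffset_param k lambda n a :
  diffset_elt k lambda n a -> k ^+ 2 = n + lambda * #|gT|%:Z.
Proof.
case=> kE aaE; have := congr1 zgr_aug aaE.
by rewrite zgr_augM zgr_aug_star kE zgr_augDMz zgr_aug1 zgr_augT expr2 => ->; ring.
Qed.

(** * Products in a reduced linking system *)

Section Linking.
Variables k lambda n M nu : int.
Let ds := diffset_elt k lambda n.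

(** Let w = a b* . From b* b = a a* = n + lambda J we get
    w w* = n (n + lambda J) + k^2 lambda J, and from w = M e + nu J we get
    w w* = M^2 (n + lambda J) + (2 M nu k + v nu^2) J. The difference of the
    coefficients at 1 and at some g <> 1 is n^2 = M^2 n; the coefficient at g,
    with k^2 = M k + nu v (augmentation of w), gives the second identity. *)
Lemma linking_param a b e :
    k != 0 -> n != 0 -> (1 < #|gT|)%N -> ds a -> ds b -> ds e ->
    a * zgr_star b = e *~ M + J *~ nu ->
  n = M ^+ 2 /\ lambda * k = M * nu + nu * k.
Proof.
move=> k_neq0 n_neq0 gT_gt1 a_ds b_ds e_ds abE.
have [kaE aaE] := a_ds; have [keE eeE] := e_ds.
have [_ /=] := diffset_elt_star b_ds; rewrite zgr_starK => bbE.
have augE : k ^+ 2 = M * k + nu * #|gT|%:Z.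
  have := congr1 zgr_aug abE.
  by rewrite zgr_augM zgr_aug_star zgr_augDMz zgr_augT kaE keE b_ds.1 expr2 => ->; ring.
have normE : (1 *~ n + J *~ lambda) *~ n + J *~ (k * k * lambda)
    = (1 *~ n + J *~ lambda) *~ (M * M)
      + J *~ (2 * M * nu * k + #|gT|%:Z * nu * nu).
  transitivity (a * zgr_star b * zgr_star (a * zgr_star b)).
    rewrite zgr_starM zgr_starK mulrA -(mulrA a) bbE -zgr_central -[RHS]mulrA aaE.
    rewrite mulrDr !mulrzAr mulr1 zgr_mulT -{3}aaE zgr_augM zgr_aug_star kaE.
    by rewrite -mulrzA.
  rewrite abE zgr_star_comb mulrDl !mulrDr.
  rewrite !mulrzAl !mulrzAr eeE zgr_mulT zgr_Tmul keE zgr_mulT zgr_aug_star keE.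
  rewrite zgr_augT -!mulrzA -!addrA; congr (_ + _).
  by rewrite -!mulrzDr; congr (_ *~ _); ring.
have [g _ g_neq1] : exists2 g : gT, g \in [set: gT] & g != 1%g.
  by apply/trivgPn; rewrite trivg_card1 cardsT gtn_eqF.
have coefE x : ((x == 1%g)%:R * n + lambda) * n + k * k * lambda
    = ((x == 1%g)%:R * n + lambda) * (M * M)
      + (2 * M * nu * k + #|gT|%:Z * nu * nu).
  have := congr1 (zgr_coef x) normE.
  by rewrite !raddfD /= !zgr_coefMz !raddfD /= !zgr_coefMz zgr_coef1 zgr_coef_setT !mul1r.
have := coefE 1%g; have := coefE g.
  rewrite eqxx (negPf g_neq1) mul0r add0r mul1r => Eg E1.
have nE : n = M ^+ 2.
  by apply: (mulfI n_neq0); lra.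
split=> //; apply: (mulfI k_neq0).
have := congr1 ( *%R nu) augE; rewrite nE in Eg; lra.
Qed.

Hypotheses (M_neq0 : M != 0) (nE : n = M ^+ 2)
           (lambda_k : lambda * k = M * nu + nu * k).

(** Multiply a b* = M e + nu J by a* on the left: since a* a = n + lambda J,
    M (a* e) = n b* + (lambda k - nu k) J = M (M b* + nu J). *)
Lemma linking_starl a b e :
    ds a -> ds b -> a * zgr_star b = e *~ M + J *~ nu ->
  zgr_star a * e = zgr_star b *~ M + J *~ nu.
Proof.
move=> a_ds [kbE _] abE; have [kaE _] := a_ds.
have [_ /=] := diffset_elt_star a_ds; rewrite zgr_starK => aaE.
apply: (zgr_mulIz M_neq0) => /=.
rewrite -mulrzAr -[e *~ M](addrK (J *~ nu)) -abE mulrBr mulrA aaE.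
rewrite mulrDl mulrzAr !mulrzAl mul1r zgr_Tmul zgr_mulT !zgr_aug_star kaE kbE.
rewrite mulrzDl -!mulrzA -expr2 -nE -addrA -mulrzBr; congr (_ + _ *~ _).
by rewrite mulrC lambda_k; ring.
Qed.

(** The image of [linking_starl] under the involution, with a and b
    exchanged. *)
Lemma linking_starr a b e :
    ds a -> ds b -> a * zgr_star b = e *~ M + J *~ nu ->
  e * b = a *~ M + J *~ nu.
Proof.
move=> a_ds b_ds /(congr1 zgr_star).
rewrite zgr_starM zgr_starK zgr_star_comb => baE.
apply: (can_inj zgr_starK); rewrite zgr_starM (linking_starl b_ds a_ds baE).
by rewrite zgr_star_comb.
Qed.

(** M e f = (a b* - nu J) f = a (b* f) - nu k J, and b* f = M c* + nu J by
    [linking_starl]; the multiples of J cancel. *)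
Lemma linking_mul a b c e f :
    ds a -> ds b -> ds c -> ds f ->
    a * zgr_star b = e *~ M + J *~ nu -> b * zgr_star c = f *~ M + J *~ nu ->
  e * f = a * zgr_star c.
Proof.
move=> [kaE _] b_ds c_ds [kfE _] abE bcE; apply: (zgr_mulIz M_neq0) => /=.
rewrite -mulrzAl -[e *~ M](addrK (J *~ nu)) -abE mulrBl -mulrA.
rewrite (linking_starl b_ds c_ds bcE) mulrDr !mulrzAr mulrzAl zgr_mulT zgr_Tmul.
by rewrite kaE kfE addrK.
Qed.

End Linking.

End GroupRingTheory.

(** * Equivalence of linking systems and reduced linking systems *)

Lemma reduced_of_linking (gT : finGroupType) (v : nat)
    (k lambda n mu nu : int) (l : nat) (D : 'I_l.+1 -> 'I_l.+1 -> {set gT}) :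
  linking_system v k lambda n mu nu D ->
  reduced_linking_system v k lambda n mu nu
    (fun i : 'I_l => D (lift ord0 i) ord0).
Proof.
case=> l_ge2 D_ds D_mul D_inv; split=> // [i | i j i_neq_j].
  by apply: D_ds; rewrite eq_sym neq_lift.
exists (D (lift ord0 i) (lift ord0 j)).
  by apply: D_ds; rewrite (inj_eq lift_inj).
by rewrite -D_inv ?neq_lift //; apply: D_mul;
  rewrite ?(inj_eq lift_inj) ?neq_lift // eq_sym neq_lift.
Qed.

(** In the degenerate cases D = set0 and D = G, all the sets involved are one
    set T, which is closed under inversion, and the single relation
    T T* = M T + nu J supplied by the reduced system is every linking relation.
    Here mu = nu is possible, so that nothing could be cancelled. *)
Lemma constant_linking_system (gT : finGroupType) (v : nat)
    (k lambda n mu nu : int) (l : nat) (T : {set gT}) :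
    (forall D, difference_set v k lambda n D -> D = T) ->
  forall Dr : 'I_l -> {set gT},
    reduced_linking_system v k lambda n mu nu Dr ->
  linking_system v k lambda n mu nu (fun _ _ : 'I_l.+1 => T).
Proof.
move=> T_uniq Dr [l_ge2 Dr_ds Dr_mul].
pose i0 : 'I_l := Ordinal (ltnW l_ge2); pose i1 : 'I_l := Ordinal l_ge2.
have T_ds : difference_set v k lambda n T.
  by rewrite -(T_uniq _ (Dr_ds i0)); apply: Dr_ds.
have TV : (T^-1)%g = T by apply: T_uniq; apply: difference_setV.
split=> // [_ _ _ _ _ _ | _ _ _]; last by rewrite zgr_setV_inv TV.
have [S S_ds] := Dr_mul i0 i1 isT.
rewrite (T_uniq _ S_ds) (T_uniq _ (Dr_ds i0)) (T_uniq _ (Dr_ds i1)).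
by rewrite zgr_setV_inv TV.
Qed.

Lemma linking_of_reduced (gT : finGroupType) (v : nat)
    (k lambda n mu nu : int) (l : nat) (Dr : 'I_l -> {set gT}) :
    reduced_linking_system v k lambda n mu nu Dr ->
  exists2 D : 'I_l.+1 -> 'I_l.+1 -> {set gT},
    linking_system v k lambda n mu nu D &
    forall i : 'I_l, D (lift ord0 i) ord0 = Dr i.
Proof.
move=> Dr_red; have [l_ge2 Dr_ds Dr_mul] := Dr_red.
pose i0 : 'I_l := Ordinal (ltnW l_ge2); pose i1 : 'I_l := Ordinal l_ge2.
have [k0 | k_neq0] := eqVneq k 0.
  have uniq (D : {set gT}) : difference_set v k lambda n D -> D = set0.
    by case=> _ kE _ _; apply/eqP; rewrite -cards_eq0 -eqz_nat kE k0.
  exists (fun _ _ => set0) => [|i]; last by rewrite (uniq _ (Dr_ds i)).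
  exact: constant_linking_system uniq _ Dr_red.
have [kv | k_neqv] := eqVneq k v.
  have uniq (D : {set gT}) : difference_set v k lambda n D -> D = setT.
    case=> vE kE _ _; apply/eqP; rewrite eqEcard subsetT cardsT vE /=.
    by rewrite -lez_nat kE kv.
  exists (fun _ _ => setT) => [|i]; last by rewrite (uniq _ (Dr_ds i)).
  exact: constant_linking_system uniq _ Dr_red.
have [vE kE _ _] := Dr_ds i0.
have gT_gt1 : (1 < #|gT|)%N.
  have D_le : (#|Dr i0| <= #|gT|)%N := max_card _.
  move: k_neq0 k_neqv; rewrite -vE -kE; move: D_le.
  by move: #|Dr i0| #|gT| => c w; lia.
have Dr_elt i : diffset_elt k lambda n (zgr_set (Dr i)).
  by case/difference_setE: (Dr_ds i).
have n_neq0 : n != 0.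
  have /difference_setE[_ nE D_elt] := Dr_ds i0.
  (* If n = 0 then lambda = k, and k^2 = n + lambda v reads k^2 = k v. *)
  apply/eqP => n0; have lambdaE : lambda = k by lia.
  have /eqP := diffset_param D_elt.
  by rewrite n0 add0r lambdaE vE expr2 (inj_eq (mulfI k_neq0)) (negPf k_neqv).
(* Choose the sets D(i,j) at once, with arbitrary values on the diagonal. *)
have {Dr_mul} /fin_all_exists[E E_P] (ij : 'I_l * 'I_l) :
    exists S, ij.1 != ij.2 -> difference_set v k lambda n S /\
      zgr_set (Dr ij.1) * zgr_star (zgr_set (Dr ij.2))
        = zgr_set S *~ (mu - nu) + zgr_set [set: gT] *~ nu.
  have [_ | ij_neq] := eqVneq ij.1 ij.2; first by exists set0.
  have [S S_ds S_mul] := Dr_mul _ _ ij_neq.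
  by exists S => _; rewrite zgr_star_set.
have E_ds i j : i != j -> difference_set v k lambda n (E (i, j)).
  by move=> /(E_P (i, j))[].
have E_elt i j : i != j -> diffset_elt k lambda n (zgr_set (E (i, j))).
  by move=> /E_ds/difference_setE[].
have E_mul i j : i != j -> zgr_set (Dr i) * zgr_star (zgr_set (Dr j))
    = zgr_set (E (i, j)) *~ (mu - nu) + zgr_set [set: gT] *~ nu.
  by move=> /(E_P (i, j))[].
have i01 : i0 != i1 by [].
have [nE lambda_k] := linking_param k_neq0 n_neq0 gT_gt1 (Dr_elt i0) (Dr_elt i1)
                        (E_elt _ _ i01) (E_mul _ _ i01).
have M_neq0 : mu - nu != 0 by apply: contraNneq n_neq0 => M0; rewrite nE M0.
have E_star i j : i != j -> zgr_set (E (i, j)) = zgr_star (zgr_set (E (j, i))).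
  move=> ij_neq; apply: (zgr_mulIz M_neq0) => /=.
  apply: (addIr (zgr_set [set: gT] *~ nu)); rewrite -E_mul //.
  rewrite -zgr_star_comb -E_mul 1?eq_sym //.
  by rewrite zgr_starM zgr_starK.
pose D (i j : 'I_l.+1) := match unlift ord0 i, unlift ord0 j with
  | Some i', Some j' => E (i', j')
  | Some i', None => Dr i'
  | None, Some j' => ((Dr j')^-1)%g
  | None, None => set0
  end.
have setVE S : zgr_set (S^-1)%g = zgr_star (zgr_set S) :> zgroup_ring gT.
  by rewrite zgr_star_set zgr_setV_inv.
exists D; last by move=> i; rewrite /D liftK unlift_none.
split=> // [i j | h i j | i j]; rewrite /D.
- case: (unliftP ord0 i) => [i'|] ->; case: (unliftP ord0 j) => [j'|] -> //.
    by rewrite (inj_eq lift_inj); apply: E_ds.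
  by move=> _; apply: difference_setV.
- case: (unliftP ord0 h) => [h'|] ->; case: (unliftP ord0 i) => [i'|] ->;
    case: (unliftP ord0 j) => [j'|] ->; rewrite ?(inj_eq lift_inj) ?eqxx //.
  + move=> hi ij hj; rewrite -E_mul //.
    exact: (linking_mul M_neq0 nE lambda_k (Dr_elt h') (Dr_elt i') (Dr_elt j')
              (E_elt _ _ ij) (E_mul _ _ hi) (E_mul _ _ ij)).
  + move=> hi _ _.
    exact: (linking_starr M_neq0 nE lambda_k (Dr_elt _) (Dr_elt _) (E_mul _ _ hi)).
  + by move=> _ _ hj; rewrite setVE E_mul.
  + move=> _ ij _; rewrite !setVE.
    exact: (linking_starl M_neq0 nE lambda_k (Dr_elt _) (Dr_elt _) (E_mul _ _ ij)).
- case: (unliftP ord0 i) => [i'|] ->; case: (unliftP ord0 j) => [j'|] ->;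
    rewrite ?(inj_eq lift_inj) ?eqxx // -zgr_star_set ?setVE ?zgr_starK //.
  exact: E_star.
Qed.

(* [lift ord0 i : 'I_l.+1] has value i + 1: index i : 'I_l of a reduced system
   corresponds to the index i + 1 in {1, ..., l}. *)
Theorem proposition1p7 (gT : finGroupType) (v : nat) (k lambda n mu nu : int)
    (l : nat) (order_gT : #|gT| = v) (l_ge2 : (2 <= l)%N) :
  (forall D : 'I_l.+1 -> 'I_l.+1 -> {set gT},
     linking_system v k lambda n mu nu D ->
     reduced_linking_system v k lambda n mu nu
       (fun i : 'I_l => D (lift ord0 i) ord0)) /\
  (forall Dr : 'I_l -> {set gT},
     reduced_linking_system v k lambda n mu nu Dr ->
     exists2 D : 'I_l.+1 -> 'I_l.+1 -> {set gT},
       linking_system v k lambda n mu nu D &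
       forall i : 'I_l, D (lift ord0 i) ord0 = Dr i).
Proof.
split; first exact: reduced_of_linking.
exact: linking_of_reduced.
Qed.
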